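(* Let $p$ be an odd prime, $n\ge 1$, and let $G=\mathrm{Hol}(C_{p^n})$, with the presentation $$G=\langle a,b \mid a^{p^n}=1,\ b^{p^{n-1}(p-1)}=1,\ b^{-1}ab=a^r\rangle,$$ where $r$ has multiplicative order $p^{n-1}(p-1)$ modulo $p^n$. For $m\ge 1$ let $\Phi_m(X)$ denote the $m$-th cyclotomic polynomial. Then: 1. The set of all inequivalent irreducible $\mathbb{Q}$-representations of $G$ whose kernels contain $G'$ is in bijective correspondence with the Galois conjugacy classes (over $\mathbb{Q}$) of complex degree $1$ representations of $G$, and also in bijective correspondence with the monic irreducible polynomials $\Phi_d(X)$, as $d$ varies over the divisors of $\phi(p^n)$. 2. The set of all inequivalent irreducible $\mathbb{Q}$-representations of $G$ whose kernels do not contain $G'$ is in bijective correspondence with the family of all monic irreducible polynomials $\Phi_1(X),\Phi_p(X),\dots,\Phi_{p^{n-k}}(X)$, where $k$ runs over $\{1,2,\dots,n\}$; that is, with the set of pairs $(k,\Phi_{p^j}(X))$ with $1\le k\le n$ and $0\le j\le n-k$. 3. The number of inequivalent irreducible $\mathbb{Q}$-representations of $G$ is equal to $d+\frac{n(n+1)}{2}$, where $d$ is the number of divisors of $\phi(p^n)$.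
   Context: $C_m$ is the cyclic group of order $m$; $\mathrm{Hol}(C_m)=C_m\rtimes\mathrm{Aut}(C_m)$ for the natural action; $\phi$ is Euler's function; $G'$ is the commutator subgroup of $G$. Two irreducible complex representations of $G$ with characters $\chi,\chi'$ are Galois conjugate over $\mathbb{Q}$ if $\chi'=\sigma\circ\chi$ for some $\sigma\in\mathrm{Gal}(\mathbb{Q}(\chi)/\mathbb{Q})$, where $\mathbb{Q}(\chi)$ is the field generated by the values of $\chi$. *)

(* Defs.v *)
From HB Require Import structures.
From mathcomp Require Import all_boot all_order all_algebra all_fingroup.
From mathcomp Require Import all_solvable all_field all_character.
From mathcomp Require Import boolp classical_sets functions cardinality.

Set Implicit Arguments.
Unset Strict Implicit.
Unset Printing Implicit Defensive.

Import GroupScope GRing.Theory.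
Local Open Scope classical_set_scope.
Local Open Scope ring_scope.

(* [sdprod_by] takes right actions, and permutations compose from left to
   right, so that [Aut C] acts on the right; composing with inversion gives the
   usual left semidirect product. *)
Definition Hol (gT : finGroupType) (C : {group gT}) :
  {group sdprod_by [Aut C]%gact} := [set: sdprod_by [Aut C]%gact]%G.

Definition classes_of (T : Type) (E : T -> T -> Prop) (A : set T) :
  set (set T) := (fun x => [set y | E x y]) @` A.

Section Representations.

Variables (gT : finGroupType) (G : {group gT}).

(* Finite-dimensional rational matrix representations, of any degree. *)
Definition Qrep := {m : nat & mx_representation rat G m}.

Definition Qrep_irr (rho : Qrep) : Prop := mx_irreducible (projT2 rho).

Definition Qrep_equiv (rho rho' : Qrep) : Prop :=
  mx_rsim (projT2 rho) (projT2 rho').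

Definition Qrep_ker (rho : Qrep) : {set gT} := rker (projT2 rho).

(* The isomorphism classes of irreducible rational representations that
   satisfy P (for P invariant under isomorphism). *)
Definition Qirr_classes (P : Qrep -> Prop) : set (set Qrep) :=
  classes_of Qrep_equiv [set rho | Qrep_irr rho /\ P rho].

(* The field Q(chi) is realised as the subfield <<1 & v(G)>> of a number field
   L embedded by iota in the complex numbers, where v lifts the values of chi
   along iota. *)
Definition galois_conjugate (chi chi' : 'CF(G)) : Prop :=
  exists (L : splittingFieldType rat) (iota : {rmorphism L -> algC})
         (v : gT -> L),
    (forall x, x \in G -> chi x = iota (v x)) /\
    exists2 sigma : gal_of <<1 & [seq v x | x in G]>>%AS,
      sigma \in 'Gal(<<1 & [seq v x | x in G]>> / 1)%g
    & forall x, x \in G -> chi' x = iota (sigma (v x)).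

Definition galois_classes_degree1 : set (set (mx_representation algC G 1)) :=
  classes_of (fun rho rho' => galois_conjugate (cfRepr rho) (cfRepr rho'))
             [set: mx_representation algC G 1].

End Representations.

Arguments galois_classes_degree1 {gT} G.

(* The integral cyclotomic polynomial 'Phi_m, viewed over the rationals. *)
Definition PhiQ (m : nat) : {poly rat} := map_poly (intr : int -> rat) 'Phi_m.

(* Main.v *)
Require Import Defs.
From HB Require Import structures.
From mathcomp Require Import all_boot all_order all_algebra all_fingroup.
From mathcomp Require Import all_solvable all_field all_character.
From mathcomp Require Import zify.
From mathcomp Require Import boolp classical_sets functions cardinality.

Set Implicit Arguments.
Unset Strict Implicit.
Unset Printing Implicit Defensive.

Import GroupScope GRing.Theory.
Local Open Scope classical_set_scope.
Local Open Scope card_scope.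
Local Open Scope ring_scope.

(* By Artin's theorem, irreducible rational representations are counted by the
   conjugacy classes of cyclic subgroups: rational characters are independent
   and take equal values on generators of conjugate cyclic subgroups, while the
   permutation characters on the cosets of the cyclic subgroups are independent
   by triangularity. Applied to the cyclic group G / G' this yields the divisors
   of phi(p^n), which also classify, by the order of the value at a generator,
   the linear characters up to Galois conjugacy. In G = <a> ><| <b>, an element
   u c with u in <b> and c in <a> is conjugate to u unless u has order p^s < p^n
   and c has order p^t with s < t <= n, and then s and t determine the class of
   <u c>: this is where the extra n (n + 1) / 2 classes come from. The key fact
   is that 1 + q + ... + q^(p^s - 1) has p-adic valuation s if q = 1 mod p. *)

(** * Rational characters and Artin's theorem *)

Lemma ratG_pchar (gT : finGroupType) (G : {group gT}) : [pchar rat]^'.-group G.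
Proof. by apply/pgroupP => q _ _; rewrite inE /= Num.Theory.pchar_num. Qed.

(** [socle_exists] holds under [classically], hence serves boolean goals only; [asbool] makes this
    goal boolean. *)
Lemma socleType_inhabited (F : fieldType) (gT : finGroupType) (G : {group gT})
    (m : nat) (rG : mx_representation F G m) : inhabited (socleType rG).
Proof.
by apply/asboolP; apply: (socle_exists rG) => sG; apply/asboolP; exists.
Qed.

Section RationalCharacters.

Variables (gT : finGroupType) (G : {group gT}) (sG : irrType rat G).

Let chi (i : sG) x : rat := \tr (irr_repr i x).

(** By Maschke's theorem the representation is the sum of its isotypic components; [c i] adds up the
    multiplicities of those of type [i]. *)
Lemma mxtrace_irr_decomp m (rG : mx_representation rat G m) :
  exists c : sG -> rat, {in G, forall x, \tr (rG x) = \sum_i c i * chi i x}.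
Proof.
have [sR] := socleType_inhabited rG.
have rat'G := ratG_pchar G.
have soc1 : (Socle sR :=: 1%:M)%MS.
  by rewrite (reducible_Socle1 sR (mx_Maschke_pchar rG rat'G)).
pose f (W : sR) := irr_comp sG (socle_repr W).
exists (fun i => \sum_(W | f W == i) (socle_mult W)%:R) => x Gx.
rewrite -(mxtrace_submod1 (Socle_module sR) soc1) // mxtrace_Socle //.
under [RHS]eq_bigr => i _ do rewrite mulr_suml.
rewrite (exchange_big_dep xpredT) //=; apply: eq_bigr => W _.
rewrite (big_pred1 (f W)) => [|i]; last by rewrite /= eq_sym.
rewrite mulr_natl /chi -(mxtrace_rsim (rsim_irr_comp_pchar sG rat'G (socle_irr W))) //.
Qed.

(* Characters extend to the group algebra, where the central idempotent of one
   irreducible component vanishes on all the others. *)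
Lemma mxtrace_irr_free (c : sG -> rat) :
  {in G, forall x, \sum_i c i * chi i x = 0} -> forall i, c i = 0.
Proof.
move=> c0 i; have rat'G := ratG_pchar G.
have trE A : (A \in group_ring rat G)%MS ->
    \sum_j c j * \tr (gring_op (irr_repr j) A) = 0.
  case/envelop_mxP=> a ->.
  transitivity (\sum_j \sum_(x in G) a x * (c j * chi j x)).
    apply: eq_bigr => j _; rewrite !linear_sum mulr_sumr; apply: eq_bigr => x Gx.
    by rewrite !linearZ /= gring_opG // mulrCA.
  rewrite exchange_big big1 //= => x Gx.
  by rewrite -mulr_sumr c0 ?mulr0.
have Re (j : sG) : (Wedderburn_id j \in Wedderburn_subring j)%MS by exact: Wedderburn_id_mem.
have /trE : (Wedderburn_id i \in group_ring rat G)%MS.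
  by rewrite -(Wedderburn_sum_pchar sG rat'G) (sumsmx_sup i).
rewrite (bigD1 i) //= big1 ?addr0 => [|j ne_ji]; last first.
  by rewrite (irr_repr'_op0_pchar rat'G _ (Re i)) 1?eq_sym // linear0 mulr0.
(* On component [i] the idempotent acts as the identity, so its trace is the degree, nonzero in
   [rat]. *)
rewrite op_Wedderburn_id_pchar // mxtrace1 => /eqP; rewrite mulf_eq0.
by rewrite Num.Theory.pnatr_eq0 -[_ == 0%N]negbK -lt0n irr_degree_gt0 orbF => /eqP.
Qed.

End RationalCharacters.

(* The trace at x is a sum of roots of unity, mapped to the trace at x^k by a
   field automorphism, which must fix it as it is rational. *)
Lemma mxtrace_rat_coprime (gT : finGroupType) (G : {group gT}) m
    (rG : mx_representation rat G m) x k :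
  x \in G -> coprime k #[x] -> \tr (rG (x ^+ k)%g) = \tr (rG x).
Proof.
move=> Gx co_k_x; have sxG : <[x]>%g \subset G by rewrite cycle_subG.
(* Restricted to [<[x]>] and taken over [algC], the character is a sum of linear characters. *)
pose rC := map_repr (ratr : rat -> algC) (subg_repr rG sxG).
have rE y : y \in <[x]>%g -> cfRepr rC y = ratr (\tr (rG y)).
  by move=> xy; rewrite cfunE xy mulr1n /= /map_repr /= trace_map_mx.
(* [u] raises roots of unity of order dividing [#[x]] to the power [k]. *)
have [u Du] := Qn_aut_exists co_k_x.
have uE : u (cfRepr rC x) = cfRepr rC (x ^+ k)%g.
  rewrite [cfRepr rC]cfun_sum_cfdot !sum_cfunE rmorph_sum.
  apply: eq_bigr => i _; rewrite !cfunE rmorphM /=.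
  have lin_i : 'chi_i \is a linear_char by apply/char_abelianP; rewrite ?cycle_abelian.
  rewrite (Du ('chi_i x)); last first.
    by rewrite -(lin_charX lin_i) ?cycle_id // expg_order lin_char1.
  rewrite (lin_charX lin_i) ?cycle_id //; congr (_ * _).
  by apply: Num.Theory.aut_natr; apply: Cnat_cfdot_char_irr; apply: cfRepr_char.
apply: (fmorph_inj (ratr : {rmorphism rat -> algC})) => /=.
by rewrite -[LHS]rE ?mem_cycle ?cycle_id // -uE rE ?cycle_id // fmorph_rat.
Qed.

(** This is the permutation representation on right cosets; the trace of a permutation matrix counts
    fixed points. *)
Lemma rcosets_repr (gT : finGroupType) (G H : {group gT}) :
  exists m (rG : mx_representation rat G m), {in G, forall x,
    \tr (rG x) = #|[set A in rcosets H G | A :* x == A]|%:R}.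
Proof.
pose R := rcosets H G; pose m := #|R|.
have RM A x : A \in R -> x \in G -> A :* x \in R.
  case/rcosetsP=> y Gy -> Gx; rewrite -rcosetM.
  by apply/rcosetsP; exists (y * x)%g; rewrite ?groupM.
pose P x : 'M[rat]_m := \matrix_(i, j) (enum_val i :* x == enum_val j)%:R.
have Prepr : mx_repr G P.
  split=> [|x y Gx Gy]; apply/matrixP=> i j; rewrite !mxE.
    by rewrite rcoset1 (inj_eq enum_val_inj).
  have Rix : enum_val i :* x \in R by rewrite RM ?enum_valP.
  rewrite (bigD1 (enum_rank_in Rix (enum_val i :* x))) //= big1 ?addr0.
    by rewrite !mxE enum_rankK_in // eqxx mul1r rcosetM.
  move=> l; apply: contraNeq; rewrite !mxE.
  case: (_ :* x =P _) => [Ail _ | _]; last by rewrite mul0r eqxx.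
  by apply/eqP/enum_val_inj; rewrite enum_rankK_in // -Ail.
exists m, (MxRepresentation Prepr) => x Gx /=.
rewrite /mxtrace -sum1_card natr_sum.
transitivity (\sum_(i < m) (enum_val i :* x == enum_val i)%:R : rat).
  by apply: eq_bigr => i _; rewrite mxE.
transitivity (\sum_(A in R) (A :* x == A)%:R : rat).
  exact: (esym (big_enum_val (fun A => (A :* x == A)%:R : rat))).
rewrite big_mkcond [RHS]big_mkcond /=; apply: eq_bigr => A _.
by rewrite inE; case: (A \in R); case: eqP.
Qed.

Lemma cycle_eq_expg (gT : finGroupType) (x y : gT) :
  <[x]>%g = <[y]>%g -> exists2 k, coprime k #[x] & y = (x ^+ k)%g.
Proof.
move=> eq_xy; have /cycleP[k Dy] : y \in <[x]>%g by rewrite eq_xy cycle_id.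
by exists k => //; rewrite coprime_sym -generator_coprime -Dy /generator eq_xy.
Qed.

(** A character is a class function, and a rational one is constant on the generators of a cyclic
    group. *)
Lemma mxtrace_cycle_conj (gT : finGroupType) (G : {group gT}) m
    (rG : mx_representation rat G m) x y :
    x \in G -> <[y]>%g \in (<[x]> :^: G)%g ->
  \tr (rG y) = \tr (rG x).
Proof.
move=> Gx /imsetP[g Gg]; rewrite -cycleJ => /esym/cycle_eq_expg[k co_k ->].
rewrite (mxtrace_rat_coprime _ _ co_k) ?groupJ // /conjg.
by rewrite !repr_mxM ?groupM ?groupV // mxtrace_mulC repr_mxK.
Qed.

(* Artin: the number of irreducible rational representations of G is the
   number of conjugacy classes of cyclic subgroups of G. Here X represents
   these classes, and inv is an invariant that tells the members of X apart. *)
Theorem card_irr_rat (gT : finGroupType) (G : {group gT}) (sG : irrType rat G)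
    (T : eqType) (inv : gT -> T) (X : seq gT) :
    {subset X <= G} -> uniq (map inv X) ->
    (forall x y, x \in G -> <[y]>%g \in (<[x]> :^: G)%g -> inv y = inv x) ->
    (forall x, x \in G -> exists2 y, y \in X & <[x]>%g \in (<[y]> :^: G)%g) ->
  #|sG| = size X.
Proof.
move=> sXG uX invJ Xall.
have Xinj i j : (i < size X)%N -> (j < size X)%N ->
    <[nth 1%g X j]>%g \in (<[nth 1 X i]> :^: G)%g -> i = j.
  move=> lt_i lt_j /invJ; rewrite sXG ?mem_nth // -!(nth_map _ (inv 1%g)) //.
  by move=> /(_ isT)/eqP; rewrite nth_uniq ?size_map // => /eqP.
pose xs (i : 'I_(size X)) := nth 1%g X i.
have Gxs i : xs i \in G by rewrite sXG ?mem_nth.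
(* One column per class of cyclic subgroups; independence of the rows bounds [#|sG|] by [size X]. *)
pose Chi : 'M[rat]_(#|sG|, size X) :=
  \matrix_(i, j) \tr (irr_repr (enum_val i) (xs j)).
have freeT : row_free Chi.
  apply: inj_row_free => v vT0; apply/rowP=> i; rewrite mxE.
  rewrite -[i in v _ i]enum_valK.
  apply: (@mxtrace_irr_free _ _ sG (fun j => v 0 (enum_rank j))) => x Gx.
  have [_ /(nthP 1%g)[j lt_j <-] xj] := Xall x Gx.
  move/rowP/(_ (Ordinal lt_j)): vT0; rewrite !mxE (reindex enum_rank) /=; last first.
    by apply: onW_bij; exists enum_val; [apply: enum_rankK | apply: enum_valK].
  move=> vT0; rewrite -[RHS]vT0; apply: eq_bigr => l _; rewrite mxE enum_rankK.
  by rewrite (mxtrace_cycle_conj _ _ xj) // (Gxs (Ordinal lt_j)).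
have perm_decomp i : exists c : sG -> rat, {in G, forall x,
    #|[set A in rcosets <[xs i]> G | A :* x == A]|%:R
      = \sum_l c l * \tr (irr_repr l x)}.
  have [m [rG DrG]] := rcosets_repr G <[xs i]>.
  have [c Dc] := mxtrace_irr_decomp sG rG.
  by exists c => x Gx; rewrite -DrG // Dc.
have [D DD] := fin_all_exists perm_decomp.
(* The permutation characters on the cosets of the [<[xs i]>]. This matrix factors through [Chi], so
   its invertibility gives the opposite bound. *)
pose Pi : 'M[rat]_(size X) :=
  \matrix_(i, j) #|[set A in rcosets <[xs i]> G | A :* xs j == A]|%:R.
have DPi : Pi = (\matrix_(i, l) D i (enum_val l)) *m Chi.
  apply/matrixP=> i j; rewrite !mxE DD //.
  rewrite (reindex (fun l : 'I_#|sG| => enum_val l)) /=; last first.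
    by apply: onW_bij; exists enum_rank; [apply: enum_valK | apply: enum_rankK].
  by apply: eq_bigr => l _; rewrite !mxE.
have Pi0 i j : Pi i j != 0 -> exists2 g, g \in G & <[xs j]>%g :^ g \subset <[xs i]>%g.
  rewrite mxE Num.Theory.pnatr_eq0 cards_eq0 => /set0Pn[A].
  rewrite inE => /andP[/rcosetsP[g Gg ->]] /eqP gj.
  exists g^-1%g; rewrite ?groupV // -cycleJ cycle_subG conjgE invgK mulgA -mem_rcoset.
  by rewrite -gj -rcosetM rcoset_refl.
have PiN i : Pi i i != 0.
  rewrite mxE Num.Theory.pnatr_eq0 cards_eq0; apply/set0Pn; exists <[xs i]>%g.
  rewrite inE rcoset_id ?cycle_id // eqxx andbT.
  by apply/rcosetsP; exists 1%g; rewrite ?rcoset1.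
(* Pi is triangular when the cyclic subgroups are sorted by order. *)
have freePi : row_free Pi.
  apply: inj_row_free => v vP0; apply/rowP=> i; rewrite mxE.
  apply/eqP/negPn/negP => vi.
  (* Let [j] have the largest order in the support of [v]. In column [j] only the diagonal
     contributes: a nonzero entry in row [l] would put a conjugate of [<[xs j]>] inside [<[xs l]>],
     which is no larger. *)
  case: (@arg_maxnP _ i (fun i => v 0 i != 0) (fun i => #[xs i]%g) vi) => j vj maxj.
  move/rowP/(_ j): vP0; rewrite !mxE (bigD1 j) //= big1 ?addr0 => [|l ne_lj].
    by apply/eqP; rewrite mulf_neq0.
  apply: contraNeq ne_lj; rewrite mulf_eq0 negb_or => /andP[vl /Pi0[g Gg sjl]].
  apply/eqP/val_inj/Xinj; rewrite ?ltn_ord //.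
  apply/imsetP; exists g^-1%g; rewrite ?groupV //.
  apply: (canRL (conjsgK g)).
  by apply/eqP; rewrite eqEcard sjl /= cardJg; apply: maxj.
apply/eqP; rewrite eqn_leq -{1}(eqP freeT) rank_leq_col /=.
by rewrite -{1}(eqP freePi) DPi (leq_trans (mxrankM_maxr _ _)) ?rank_leq_row.
Qed.

(** * Counting isomorphism classes of rational representations *)

(** The classes are taken in all of [T], not only in [A]; [h] rebuilds such a class from the value
    of the complete invariant [f]. *)
Lemma card_classes_of T U (E : T -> T -> Prop) (A : set T) (f : T -> U) :
    (forall x, E x x) -> (forall x y, E x y -> E y x) ->
    (forall x y z, E x y -> E y z -> E x z) ->
    (forall x y, A x -> A y -> E x y <-> f x = f y) ->
  classes_of E A #= f @` A.
Proof.
move=> Erefl Esym Etrans Ef.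
pose h u := [set y | exists2 x, A x & f x = u /\ E x y].
have hf x : A x -> h (f x) = [set y | E x y].
  move=> Ax; apply/seteqP; split=> y /=; last by exists x.
  by case=> z Az [/esym/Ef]; move/(_ Ax Az)/Etrans=> Exz /Exz.
suffices -> : classes_of E A = h @` (f @` A).
  apply: inj_card_eq => _ _ /[!inE] -[x Ax <-] [y Ay <-].
  rewrite !hf // => /seteqP[_ /(_ y (Erefl y)) Exy].
  exact/Ef.
apply/seteqP; split=> [_ [x Ax <-] | _ [_ [x Ax <-] <-]].
  by exists (f x); [exists x | rewrite hf].
by rewrite hf //; exists x.
Qed.

Lemma card_seq (T : eqType) (s : seq T) : uniq s -> [set x | x \in s] #= `I_(size s).
Proof.
case: s => [|x0 s] us.
  by rewrite [X in X #= _](_ : _ = set0) ?II0 //; apply/seteqP; split.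
set s1 := x0 :: s in us *.
suffices -> : [set x | x \in s1] = nth x0 s1 @` `I_(size s1).
  apply: inj_card_eq => i j; rewrite !inE /= => lt_i lt_j /eqP.
  by rewrite nth_uniq // => /eqP.
apply/seteqP; split=> x /= => [/(nthP x0)[i] | [i]] lt_i <-; last exact: mem_nth.
by exists i.
Qed.

Lemma card_finpred (T : finType) (P : pred T) : [set x | P x] #= `I_#|P|.
Proof.
rewrite cardE; have -> : [set x | P x] = [set x | x \in enum P].
  by apply/seteqP; split=> x /=; rewrite mem_enum.
exact/card_seq/enum_uniq.
Qed.

Section QirrClasses.

Variables (gT : finGroupType) (G : {group gT}).

Lemma Qrep_equiv_sym (rho rho' : Qrep G) : Qrep_equiv rho rho' -> Qrep_equiv rho' rho.
Proof. exact: mx_rsim_sym. Qed.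

Lemma Qrep_equiv_trans (rho1 rho2 rho3 : Qrep G) :
  Qrep_equiv rho1 rho2 -> Qrep_equiv rho2 rho3 -> Qrep_equiv rho1 rho3.
Proof. exact: mx_rsim_trans. Qed.

Lemma Qrep_equiv_irr (rho rho' : Qrep G) :
  Qrep_equiv rho rho' -> Qrep_irr rho -> Qrep_irr rho'.
Proof. by move=> rr'; apply: mx_rsim_irr rr'. Qed.

Lemma Qrep_equiv_ker (rho rho' : Qrep G) :
  Qrep_equiv rho rho' -> Qrep_ker rho = Qrep_ker rho'.
Proof. exact: rker_mx_rsim. Qed.

(** [irr_comp] is a complete invariant of irreducible representations, and each [i] is its value at
    [irr_repr i]. *)
Lemma card_Qirr_classes (sG : irrType rat G) (P : Qrep G -> bool) :
    (forall rho rho', Qrep_equiv rho rho' -> P rho = P rho') ->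
  Qirr_classes (fun rho : Qrep G => P rho)
    #= `I_#|[pred i : sG | P (existT _ _ (irr_repr i))]|.
Proof.
move=> Pequiv; have rat'G := ratG_pchar G.
pose R (i : sG) : Qrep G := existT _ _ (irr_repr i).
pose f (rho : Qrep G) := irr_comp sG (projT2 rho).
have fP rho : Qrep_irr rho -> Qrep_equiv rho (R (f rho)).
  exact: rsim_irr_comp_pchar.
have irrR i : Qrep_irr (R i) by exact: socle_irr.
apply: card_eq_trans (card_finpred _).
suffices <- : f @` [set rho | Qrep_irr rho /\ P rho] = [set i | P (R i)].
  apply: card_classes_of => [rho | rho rho' | r1 r2 r3 | rho rho' [irr _] [irr' _]].
  - exact: mx_rsim_refl.
  - exact: mx_rsim_sym.
  - exact: mx_rsim_trans.
  split=> [|eqf]; first exact: irr_comp_rsim_pchar.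
  by apply: Qrep_equiv_trans (fP _ irr) _; rewrite eqf; apply/Qrep_equiv_sym/fP.
apply/seteqP; split=> [_ [rho [irr Prho] <-] | i PRi] /=.
  by rewrite -(Pequiv _ _ (fP _ irr)).
by exists (R i); [split | apply: irr_reprK_pchar].
Qed.

Variable N : {group gT}.
Hypothesis nsNG : N <| G.

Let nNG : G \subset 'N(N) := normal_norm nsNG.

Let lift (s : Qrep (G / N)) : Qrep G :=
  existT _ (projT1 s) (morphim_repr (projT2 s) nNG).

(** Inflation from G / N preserves and reflects equivalence and irreducibility, and up to
    equivalence it reaches every representation trivial on N. *)
Lemma card_Qirr_classes_quotient :
  Qirr_classes (fun rho : Qrep G => N \subset Qrep_ker rho)
    #= Qirr_classes (fun _ : Qrep (G / N) => True).
Proof.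
have lift_equiv s s' : Qrep_equiv s s' <-> Qrep_equiv (lift s) (lift s').
  split=> -[B eq_n freeB homB]; exists B => // x Gx.
    by apply: homB; rewrite mem_quotient.
  by case/morphimP: Gx => y _ Gy ->; apply: (homB y).
have lift_irr s : Qrep_irr s <-> Qrep_irr (lift s).
  by apply: iff_sym; apply: morphim_mx_irr.
have lift_ker s : N \subset Qrep_ker (lift s).
  apply/fintype.subsetP=> x Nx; apply/rkerP; split=> [|/=].
    exact: (fintype.subsetP (normal_sub nsNG)).
  by rewrite /morphim_mx [coset_morphism N x]coset_id // repr_mx1.
have lift_surj (rho : Qrep G) : N \subset Qrep_ker rho -> exists s, Qrep_equiv (lift s) rho.
  case: rho => m rG krG; exists (existT _ m (quo_repr krG nNG)).
  exists 1%:M => // [|x Gx]; first by rewrite row_free_unit unitmx1.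
  by rewrite mulmx1 mul1mx; apply: quo_repr_coset.
pose f (s : Qrep (G / N)) := [set rho | Qrep_equiv (lift s) rho].
rewrite card_eq_sym.
rewrite [X in _ #= X](_ : _ = f @` [set s | Qrep_irr s /\ True]); last first.
  apply/seteqP; split=> [_ [rho [irr krho] <-] | _ [s [irr _] <-]].
    have [s rs] := lift_surj _ krho; exists s.
      by split=> //; apply/lift_irr; apply: Qrep_equiv_irr (Qrep_equiv_sym rs) irr.
    apply/seteqP; split=> y /=; last exact: Qrep_equiv_trans.
    exact/Qrep_equiv_trans/Qrep_equiv_sym.
  by exists (lift s) => //; split=> //; apply/lift_irr.
apply: card_classes_of => [s | s s' | s1 s2 s3 | s s' _ _].
- exact: mx_rsim_refl.
- exact: mx_rsim_sym.
- exact: mx_rsim_trans.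
rewrite lift_equiv; split=> [ss' | /seteqP[_ /(_ (lift s'))]]; last first.
  by apply; apply: mx_rsim_refl.
apply/seteqP; split=> y /=; last exact: Qrep_equiv_trans.
exact/Qrep_equiv_trans/Qrep_equiv_sym.
Qed.

End QirrClasses.

(** * Galois conjugacy of linear characters *)

(** Field morphisms preserve the order of a root of unity. *)
Lemma galois_conjugate_primitive_root (gT : finGroupType) (G : {group gT})
    (chi chi' : 'CF(G)) x d :
  x \in G -> galois_conjugate chi chi' ->
  d.-primitive_root (chi x) = d.-primitive_root (chi' x).
Proof.
move=> Gx [L [iota [v [Dchi [sigma _ Dchi']]]]].
by rewrite Dchi // Dchi' // !fmorph_primitive_root.
Qed.

(** [u] is restricted first to a normal number field containing the values of [chi], then to Q(chi),
    which is stable because [u] sends values of [chi] to values of [chi]. *)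
Lemma galois_conjugate_aut (gT : finGroupType) (G : {group gT})
    (chi chi' : 'CF(G)) (u : {rmorphism algC -> algC}) :
    chi \is a character -> {in G, forall x, chi' x = u (chi x)} ->
    (forall x, x \in G -> exists2 y, y \in G & u (chi x) = chi y) ->
  galois_conjugate chi chi'.
Proof.
move=> Nchi Dchi' Gchi.
have [L _ [iota _ [_ _ LchiG]]] := group_num_field_exists G.
(* The membership sits under the existential so that choice gives a function on all of [gT]; outside
   G the value 0 is used. *)
have Lchi x : exists a, x \in G -> chi x = iota a.
  case Gx: (x \in G); last by exists 0.
  by have [|a Da] := LchiG _ G chi Nchi x; [apply: order_dvdG | exists a].
have {}[v Dv] : {v : gT -> L & forall x, x \in G -> chi x = iota (v x)}.
  by exists (fun x => projT1 (cid (Lchi x))) => x; case: (cid _).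
exists L, iota, v; split=> //.
set E := <<1 & _>>%AS.
have [nu Dnu] := restrict_aut_to_normal_num_field iota u.
have Ev x : x \in G -> v x \in E.
  by move=> Gx; apply: seqv_sub_adjoin; apply/fintype.imageP; exists x.
(* Linearity over Q is automatic, and stability of [E] is checked on its generators [v x]. *)
have autE : kAut 1 E (linfun nu).
  rewrite kAutE; apply/andP; split.
    apply: kHomSr (subvf E) _; apply/kHomP; split=> [y z _ _ | y].
      by rewrite !lfunE /= rmorphM.
    by case/vlineP=> c ->; rewrite lfunE /= linearZ /= rmorph1.
  have -> : linfun nu = linfun_ahom nu :> 'End(L) by [].
  rewrite aimg_adjoin_seq aimg1; apply/Fadjoin_seqP; split; first exact: sub1v.
  move=> _ /mapP[_ /fintype.imageP[x Gx ->] ->].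
  have [y Gy uy] := Gchi x Gx; rewrite lfunE /=.
  suffices -> : nu (v x) = v y by exact: Ev.
  by apply: (fmorph_inj iota); rewrite Dnu -!Dv.
have [sigma gal_sigma Dsigma] := kAut_to_gal autE.
exists sigma => // x Gx; rewrite Dchi' // Dv //= -Dsigma ?Ev //.
by rewrite lfunE /= Dnu.
Qed.

Section CyclicAbelianization.

Variables (gT : finGroupType) (G : {group gT}) (b : gT).
Hypotheses (Gb : b \in G) (gen_b : (G / G^`(1) = <[coset G^`(1) b]>)%g).

Let N := #|G : G^`(1)|%g.

Let coset_b x : x \in G -> exists k, (coset G^`(1) x = coset G^`(1) b ^+ k)%g.
Proof.
by move=> Gx; apply/cycleP; rewrite -gen_b mem_quotient.
Qed.

Let order_b : #[coset G^`(1)%g b]%g = N.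
Proof. by rewrite /N -card_quotient ?der_norm // gen_b. Qed.

Let chi (rho : mx_representation algC G 1) := cfRepr rho.

Let lin_chi rho : chi rho \is a linear_char.
Proof. by rewrite qualifE /= cfRepr_char cfRepr1 eqxx. Qed.

(** A linear character is trivial on G', so its value at [b] determines it. *)
Let chiX rho x k : x \in G -> (coset G^`(1) x = coset G^`(1) b ^+ k)%g ->
  chi rho x = chi rho b ^+ k.
Proof.
move=> Gx xk; rewrite -(lin_charX (lin_chi rho)) //.
rewrite -[x in LHS](mulgKV (b ^+ k)%g) cfkerMl //.
apply: (fintype.subsetP (lin_char_der1 (lin_chi rho))).
have nG' : G \subset 'N(G^`(1))%g := der_norm 1 G.
apply: coset_idr; first by rewrite (fintype.subsetP nG') ?groupM ?groupV ?groupX.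
by rewrite morphM ?morphV ?morphX ?groupV ?groupX ?(fintype.subsetP nG') //= xk mulgV.
Qed.

Let chiN rho : chi rho b ^+ N = 1.
Proof.
rewrite -(chiX rho (group1 G)); first exact: lin_char1.
by rewrite -order_b expg_order coset_id.
Qed.

(** The coset of b^k goes to z^k, which is well defined since the coset of [b] has order N. *)
Lemma degree1_repr_exists (z : algC) : z ^+ N = 1 ->
  exists rho : mx_representation algC G 1, cfRepr rho b = z.
Proof.
rewrite -order_b => zN1; pose cs := coset G^`(1)%g.
(* The default 1 is never reached on G, where every coset is a power of that of [b]. *)
pose r x := if [pick k : 'I_#[cs b]%g | cs x == cs b ^+ k]%g is Some k then z ^+ k else 1.
have rE x k : (cs x = cs b ^+ k)%g -> r x = z ^+ k.
  rewrite /r => xk; case: pickP => [l /eqP | /(_ (Ordinal (ltn_pmod k (order_gt0 _))))]; last first.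
    by rewrite /= expg_mod_order xk eqxx.
  rewrite xk => /eqP; rewrite eq_expg_mod_order => /eqP kl.
  by rewrite -(expr_mod k zN1) kl expr_mod.
have nG' : G \subset 'N(G^`(1))%g := der_norm 1 G.
have r_repr : mx_repr G (fun x => (r x)%:M : 'M_1).
  split=> [|x y Gx Gy]; first by rewrite (rE _ 0%N) // /cs coset_id.
  have [[k xk] [l yl]] := (coset_b Gx, coset_b Gy).
  rewrite (rE _ _ xk) (rE _ _ yl) (rE _ (k + l)%N) -?scalar_mxM ?exprD //.
  by rewrite expgD -[in RHS]xk -[in RHS]yl; apply: morphM; rewrite ?(fintype.subsetP nG').
exists (MxRepresentation r_repr).
by rewrite cfunE Gb /= mxtrace_scalar (rE b 1%N).
Qed.

(** Roots of unity of equal order are powers of each other with coprime exponents, hence conjugate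
    under a field automorphism; every order dividing N occurs at [b]. *)
Lemma card_galois_classes_degree1 :
  galois_classes_degree1 G #= [set d | (d %| N)%N].
Proof.
have N_gt0 : (0 < N)%N by rewrite /N indexg_gt0.
(* The order of the root of unity [chi rho b], encoded as a singleton. *)
pose f rho := [set d | d.-primitive_root (chi rho b)].
have conjP rho rho' : galois_conjugate (chi rho) (chi rho') <-> f rho = f rho'.
  split=> [conj | ff'].
    apply/funext => d; rewrite /f /mkset.
    by rewrite (galois_conjugate_primitive_root d Gb conj).
  have [d prim_d _] := prim_order_exists N_gt0 (chiN rho).
  have prim_d' : d.-primitive_root (chi rho' b) by rewrite -[is_true _]/(f rho' d) -ff'.
  have [k Dk] := prim_rootP prim_d (prim_expr_order prim_d').
  have co_k_d : coprime k d by rewrite -(prim_root_exp_coprime _ prim_d) -Dk.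
  have [u Du] := Qn_aut_exists co_k_d.
  have uE x l : x \in G -> (coset G^`(1) x = coset G^`(1) b ^+ l)%g ->
      u (chi rho x) = chi rho b ^+ (k * l).
    move=> Gx xl; rewrite (chiX rho Gx xl) Du; first by rewrite -exprM mulnC.
    by rewrite exprAC (prim_expr_order prim_d) expr1n.
  apply: (@galois_conjugate_aut _ _ _ _ u) => [|x Gx|x Gx]; first exact: cfRepr_char.
    have [l xl] := coset_b Gx.
    by rewrite (uE _ _ Gx xl) (chiX rho' Gx xl) Dk exprM.
  (* If x is b^l modulo G', its conjugated value is the value at b^(kl). *)
  have [l xl] := coset_b Gx; exists (b ^+ (k * l))%g; first by rewrite groupX.
  by rewrite (uE _ _ Gx xl) (lin_charX (lin_chi rho)).
apply: card_eq_trans (_ : _ #= (fun d => [set d]) @` [set d | (d %| N)%N]) _; last first.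
  by apply: inj_card_eq => d1 d2 _ _ /seteqP[/(_ d1 erefl)].
suffices <- : f @` [set: mx_representation algC G 1] =
    (fun d => [set d]) @` [set d | (d %| N)%N].
  apply: card_classes_of => [rho | rho rho' | r1 r2 r3 | rho rho' _ _].
  - exact/conjP.
  - by move/conjP=> ff'; apply/conjP.
  - by move=> /conjP f12 /conjP f23; apply/conjP; rewrite f12.
  - exact: conjP.
have fE rho d : d.-primitive_root (chi rho b) -> f rho = [set d].
  move=> prim_d; apply/seteqP; split=> e /= => [prim_e | -> //].
  apply/eqP; rewrite eqn_dvd (prim_order_dvd prim_e) (prim_order_dvd prim_d).
  by rewrite (prim_expr_order prim_e) (prim_expr_order prim_d) eqxx.
apply/seteqP; split=> [_ [rho _ <-] | _ [d dvd_d <-]].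
  have [d prim_d dvd_d] := prim_order_exists N_gt0 (chiN rho).
  by exists d; rewrite // (fE _ _ prim_d).
have d_gt0 : (0 < d)%N := dvdn_gt0 N_gt0 dvd_d.
have [z prim_z] := C_prim_root_exists d_gt0.
have [|rho Drho] := @degree1_repr_exists z.
  by apply/eqP; rewrite -(prim_order_dvd prim_z).
by exists rho => //; apply: fE; rewrite /chi Drho.
Qed.

End CyclicAbelianization.

(** * Cyclic subgroups of the holomorph *)

Section GeometricSums.

Local Open Scope nat_scope.

Definition geom x m := \sum_(i < m) x ^ i.

Lemma geomD x m k : geom x (m + k) = geom x m + x ^ m * geom x k.
Proof.
rewrite /geom big_split_ord big_distrr; congr (_ + _).
by apply: eq_bigr => i _; rewrite expnD.
Qed.

Lemma geomM x m k : geom x (m * k) = geom x m * geom (x ^ m) k.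
Proof.
elim: k => [|k IHk]; first by rewrite muln0 /geom !big_ord0 muln0.
rewrite mulnSr geomD IHk [geom (x ^ m) k.+1]/geom big_ord_recr /= mulnDr.
by rewrite -expnM [_ ^ _ * _]mulnC.
Qed.

Lemma geom_gt0 x m : 0 < m -> 0 < geom x m.
Proof. by case: m => // m _; rewrite /geom big_ord_recl addn_gt0 expn_gt0 orbT. Qed.

Lemma geom_mod p x m : x = 1 %[mod p] -> geom x m = m %[mod p].
Proof.
move=> x1; elim: m => [|m IHm]; first by rewrite /geom big_ord0.
rewrite /geom big_ord_recr /= -modnDm IHm.
by rewrite -[x ^ m %% p]modnXm x1 modnXm exp1n modnDm addn1.
Qed.

(** Write x = 1 + pq. Modulo p^2, x^i is 1 + pqi, so the sum is p + pq C(p, 2), and p divides C(p,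
    2) because p is odd. *)
Lemma logn_geom_prime p x : prime p -> odd p -> x = 1 %[mod p] ->
  logn p (geom x p) = 1.
Proof.
move=> p_pr p_odd x1; have p_gt0 := prime_gt0 p_pr; have p_gt1 := prime_gt1 p_pr.
have p_gt2 : 2 < p by rewrite odd_prime_gt2.
have geom_eq : geom x p = p %[mod p ^ 2].
  pose q := x %/ p; have Dx : x = 1 + p * q.
    by rewrite {1}(divn_eq x p) x1 modn_small // addnC mulnC.
  have xX k : x ^ k = 1 + p * q * k %[mod p ^ 2].
    elim: k => [|k IHk]; first by rewrite muln0 addn0.
    rewrite expnS -modnMmr IHk modnMmr Dx.
    have -> : (1 + p * q) * (1 + p * q * k) = q * q * k * p ^ 2 + (1 + p * q * k.+1).
      by rewrite mulnS; lia.
    by rewrite modnMDl.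
  have -> : geom x p = \sum_(i < p) (1 + p * q * i) %[mod p ^ 2].
    rewrite /geom -modn_summ.
    by under eq_bigr => i _ do rewrite xX; rewrite modn_summ.
  rewrite big_split /= sum1_card card_ord -big_distrr /= -(big_mkord xpredT id).
  rewrite bin2_sum; have /dvdnP[w ->] : p %| 'C(p, 2) by apply: prime_dvd_bin.
  have -> : p + p * q * (w * p) = q * w * p ^ 2 + p by lia.
  by rewrite modnMDl.
have pM : p %| geom x p by rewrite /dvdn geom_mod // modnn.
have M_gt0 : 0 < geom x p by apply: geom_gt0.
apply/eqP; rewrite eqn_leq -{2}(expn1 p) -pfactor_dvdn // expn1 pM andbT.
rewrite -ltnS ltnNge -pfactor_dvdn // /dvdn geom_eq.
by rewrite modn_small -?lt0n // -{1}(expn1 p) ltn_exp2l.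
Qed.

(** By induction: the sum of length p^(s+1) is the one of length p^s times a sum of length p in
    x^(p^s), of valuation 1. *)
Lemma logn_geom p x s : prime p -> odd p -> x = 1 %[mod p] ->
  logn p (geom x (p ^ s)) = s.
Proof.
move=> p_pr p_odd x1; elim: s => [|s IHs].
  by rewrite expn0 /geom big_ord1 expn0 logn1.
have xs1 : x ^ p ^ s = 1 %[mod p] by rewrite -modnXm x1 modnXm exp1n.
rewrite expnSr geomM lognM ?IHs ?logn_geom_prime ?addn1 ?geom_gt0 ?expn_gt0 ?prime_gt0 //.
Qed.

End GeometricSums.

(** A cyclic group has one subgroup for each divisor of its order, and the order is the separating
    invariant. *)
Lemma card_irr_rat_cyclic (gT : finGroupType) (G : {group gT}) (sG : irrType rat G) :
  cyclic G -> #|sG| = size (divisors #|G|).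
Proof.
case/cyclicP=> b defG; pose X := [seq b ^+ (#[b] %/ d) | d <- divisors #[b]]%g.
have ordX d : (d %| #[b]%g)%N -> #[b ^+ (#[b] %/ d)]%g = d.
  move=> d_b; rewrite orderXdiv ?dvdn_div // divnA // mulKn //.
have mapX : map order X = divisors #[b]%g.
  rewrite -map_comp -[RHS]map_id; apply/eq_in_map => d.
  rewrite -dvdn_divisors ?order_gt0 //; apply: ordX.
have -> : #|G| = #[b]%g by rewrite defG.
rewrite -mapX size_map; apply: (@card_irr_rat _ _ _ _ order).
- by move=> _ /mapP[d _ ->]; rewrite defG mem_cycle.
- by rewrite mapX divisors_uniq.
- by move=> x y _ /imsetP[g _ eq_yx]; rewrite /order eq_yx cardJg.
move=> x Gx; have x_b : (#[x]%g %| #[b]%g)%N by rewrite /order -defG order_dvdG.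
exists (b ^+ (#[b] %/ #[x]))%g; first by apply/mapP; exists #[x]%g; rewrite // -dvdn_divisors.
apply/imsetP; exists 1%g; rewrite ?conjsg1 //; apply/eqP.
rewrite (eq_subG_cyclic (cycle_cyclic b)) ?cycle_subG ?mem_cycle -?defG //.
  by rewrite [X in _ == X](ordX _ x_b).
by rewrite -[_ \in _]/(x \in <[b]>%g) -defG.
Qed.

Lemma sum_iota_subn n : \sum_(s <- iota 0 n) (n - s)%N = (n * n.+1 %/ 2)%N.
Proof.
rewrite -[n in iota 0 n]subn0 -/(index_iota 0 n) big_nat_rev /=.
rewrite (eq_big_nat _ _ (F2 := succn)) => [|i /andP[_ lt_in]]; last first.
  by rewrite add0n subKn.
by rewrite -[LHS]add0n -(big_nat_recl n 0 id) // bin2_sum bin2 divn2 mulnC.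
Qed.

(** * Conjugacy of cyclic subgroups in <a> ><| <b> *)

Section Holomorph.

Variables (gT : finGroupType) (G : {group gT}) (p n r : nat) (a b : gT).
Hypotheses (p_pr : prime p) (p_odd : odd p) (n_gt0 : (0 < n)%N).
Hypothesis defG : (<[a]> ><| <[b]> = G)%g.
Hypothesis oa : #[a]%g = (p ^ n)%N.
Let N := (p ^ n.-1 * p.-1)%N.
Hypothesis ob : #[b]%g = N.
Hypothesis ab : (a ^ b = a ^+ r)%g.
Hypothesis prim_r : N.-primitive_root (r%:R : 'Z_(p ^ n)).

Local Open Scope group_scope.

Let pn_gt1 : (1 < p ^ n)%N.
Proof. by rewrite -(exp1n n) ltn_exp2r ?prime_gt1. Qed.

Let p_pn : (p %| p ^ n)%N. Proof. exact: dvdn_exp. Qed.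

Let nsaG : <[a]> <| G.
Proof. by case/sdprod_context: defG. Qed.

Let sbG : <[b]> \subset G.
Proof. by case/sdprod_context: defG. Qed.

Let Ga : a \in G.
Proof. by rewrite -cycle_subG normal_sub. Qed.

Let Gb : b \in G.
Proof. by rewrite -cycle_subG. Qed.

Lemma Zp_natr_eq m k : ((m%:R == k%:R :> 'Z_(p ^ n))%R) = (m == k %[mod p ^ n])%N.
Proof. by rewrite -val_eqE /= !val_Zp_nat. Qed.

Let expa_eq i j : (a ^+ i == a ^+ j) = (i == j %[mod p ^ n])%N.
Proof. by rewrite eq_expg_mod_order oa. Qed.

Let conj_bX k : a ^ (b ^+ k) = a ^+ (r ^ k).
Proof.
elim: k => [|k IHk]; first by rewrite conjg1.
by rewrite expgSr conjgM IHk conjXg ab -expgM expnS.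
Qed.

Let acts_exists u : u \in <[b]> -> exists2 q, (0 < q)%N & a ^ u = a ^+ q.
Proof.
(* Adding p^n leaves the power of [a] unchanged and makes the exponent positive, as [q.-1] requires
   later. *)
case/cycleP=> e ->{u}; exists (r ^ e + p ^ n)%N.
  by rewrite addn_gt0 orbC expn_gt0 prime_gt0.
by rewrite conj_bX expgD -[in a ^+ (p ^ n)]oa expg_order mulg1.
Qed.

(** The order of r modulo p^n equals the order of [b]. *)
Let faithful_b u : u \in <[b]> -> a ^ u = a -> u = 1.
Proof.
case/cycleP=> e ->{u}; rewrite conj_bX -{2}[a]expg1 => /eqP.
rewrite expa_eq -Zp_natr_eq natrX -(prim_order_dvd prim_r) => N_e.
by apply/eqP; rewrite -order_dvdn ob.
Qed.

(** The order N of r is the number of units modulo p^n, so r generates them all. *)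
Let b_onto_aut i : coprime i p -> exists e, a ^ (b ^+ e) = a ^+ i.
Proof.
move=> co_i_p; have N_gt0 : (0 < N)%N by apply: prim_order_gt0 prim_r.
have Ur : (r%:R : 'Z_(p ^ n))%R \is a GRing.unit.
  by rewrite -(unitrX_pos _ N_gt0) (prim_expr_order prim_r) unitr1.
have Ui : (i%:R : 'Z_(p ^ n))%R \is a GRing.unit.
  by rewrite unitZpE // coprime_sym coprimeXr.
pose ur := FinRing.unit 'Z_(p ^ n) Ur; pose ui := FinRing.unit 'Z_(p ^ n) Ui.
have our : #[ur] = N.
  apply/eqP; rewrite eqn_dvd order_dvdn (prim_order_dvd prim_r).
  rewrite -val_eqE /= FinRing.val_unitX /= (prim_expr_order prim_r) eqxx /=.
  by rewrite -[(r%:R : 'Z_(p ^ n))%R]/(val ur) -FinRing.val_unitX expg_order.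
have /cycleP[e De] : ui \in <[ur]>.
  suffices /eqP -> : <[ur]> == units_Zp (p ^ n) by rewrite inE.
  rewrite eqEcard finset.subsetT card_units_Zp ?expn_gt0 ?prime_gt0 //.
  by rewrite -orderE our totient_pfactor //= /N mulnC.
exists e; rewrite conj_bX; apply/esym/eqP; rewrite expa_eq -Zp_natr_eq natrX.
by rewrite -[(r%:R : 'Z_(p ^ n))%R]/(val ur) -FinRing.val_unitX -De.
Qed.

(* Throughout this section u acts on <a> as the power map q, so that
   (u c)^m = u^m c^(1 + q + ... + q^(m-1)) for c in <a>. *)
Section Twist.

Variables (u : gT) (q : nat).
Hypotheses (bu : u \in <[b]>) (q_gt0 : (0 < q)%N) (au : a ^ u = a ^+ q).

Let conj_u c : c \in <[a]> -> c ^ u = c ^+ q.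
Proof. by case/cycleP=> i ->; rewrite conjXg au -!expgM mulnC. Qed.

Let conj_uX m : a ^ (u ^+ m) = a ^+ (q ^ m).
Proof.
elim: m => [|m IHm]; first by rewrite conjg1.
by rewrite expgSr conjgM IHm conjXg au -expgM expnS.
Qed.

Lemma expMgeom c m : c \in <[a]> -> (u * c) ^+ m = u ^+ m * c ^+ geom q m.
Proof.
move=> ac; elim: m => [|m IHm]; first by rewrite /geom big_ord0 mulg1.
have -> : geom q m.+1 = (geom q m * q + 1)%N.
  by rewrite -add1n geomD /geom big_ord1 expn0 expn1 addnC mulnC.
rewrite expgSr IHm -mulgA (mulgA _ u) (conjgC _ u) conj_u ?groupX //.
by rewrite expgSr expgD expg1 expgM !mulgA.
Qed.

Lemma expMgeom_eq1 c m : c \in <[a]> ->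
  ((u * c) ^+ m == 1) = (u ^+ m == 1) && (c ^+ geom q m == 1).
Proof.
move=> ac; rewrite expMgeom //; apply/idP/andP=> [|[/eqP-> /eqP->]]; last by rewrite mulg1.
have [_ _ _ tiab] := sdprodP defG.
rewrite -eq_invg_mul => /eqP uc.
have : u ^+ m \in <[a]> :&: <[b]> by rewrite inE -groupV uc !groupX.
by rewrite tiab inE => /eqP um1; rewrite -uc um1 invg1 !eqxx.
Qed.

(* (a^(q-1))^(1 + q + ... + q^(m-1)) telescopes to a^(q^m - 1). *)
Lemma order_twist_dvd m : (#[a ^+ q.-1] %| geom q m)%N = (#[u] %| m)%N.
Proof.
rewrite !order_dvdn -expgM -predn_exp; apply/eqP/eqP=> [aqm | um].
  apply: faithful_b; rewrite ?groupX // conj_uX.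
  by rewrite -[(q ^ m)%N]prednK ?expn_gt0 ?q_gt0 // expgS aqm mulg1.
have := conj_uX m; rewrite um conjg1.
rewrite -[in a ^+ _](@prednK (q ^ m)) ?expn_gt0 ?q_gt0 // expgS.
by rewrite -[X in X = _]mulg1 => /mulgI <-.
Qed.

(** If p divides q - 1, then a^(q-1) has order dividing p^(n-1), which divides the geometric sum of
    that length. Conversely q^(p^(n-1)) = 1 modulo p^n, and Fermat reduces this to q = 1 modulo
    p. *)
Lemma twist_mod_p : (q == 1 %[mod p])%N = (#[u] %| p ^ n.-1)%N.
Proof.
apply/idP/idP=> [/eqP q1 | u_p].
  rewrite -order_twist_dvd (@dvdn_trans (p ^ n.-1)%N) //.
    have /dvdnP[k Dk] : (p %| q.-1)%N.
      by rewrite -subn1 -eqn_mod_dvd // q1.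
    rewrite order_dvdn -expgM Dk -mulnA -expnS prednK // mulnC expgM -oa.
    by rewrite expg_order expg1n.
  by rewrite pfactor_dvdn ?logn_geom // geom_gt0 // expn_gt0 prime_gt0.
have fermat i : (q ^ p ^ i = q %[mod p])%N.
  elim: i => [|i IHi]; first by rewrite expn0 expn1.
  by rewrite expnSr expnM fermat_little.
have /eqP qn1 : (q ^ p ^ n.-1 == 1 %[mod p ^ n])%N.
  by rewrite -expa_eq -conj_uX (eqP (_ : u ^+ _ == 1)) -?order_dvdn // conjg1.
by rewrite -(fermat n.-1) -(modn_dvdm _ p_pn) qn1 (modn_dvdm _ p_pn).
Qed.

(** The order is some p^l. It divides the geometric sum of length p^i exactly when l <= i, by
    valuations, and exactly when s <= i, by [order_twist_dvd]. *)
Lemma order_twist s : #[u] = (p ^ s)%N -> (s <= n.-1)%N -> #[a ^+ q.-1] = (p ^ s)%N.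
Proof.
move=> ou les; have /eqP q1 : (q == 1 %[mod p])%N by rewrite twist_mod_p ou dvdn_exp2l.
have : (#[a ^+ q.-1] %| p ^ n)%N by rewrite -oa orderXdvd.
case/dvdn_pfactor=> // l _ ol; rewrite ol; congr (p ^ _)%N.
have ls i : (l <= i)%N = (s <= i)%N.
  rewrite -(dvdn_Pexp2l s i (prime_gt1 p_pr)) -ou -order_twist_dvd ol.
  by rewrite pfactor_dvdn ?logn_geom ?geom_gt0 ?expn_gt0 ?prime_gt0.
by apply/eqP; rewrite eqn_leq ls leqnn -ls leqnn.
Qed.

(** The p^i-th power of u c is trivial exactly when those of u and c are, since the geometric sum of
    length p^i has valuation i. *)
Lemma order_mul_twist c s t :
    #[u] = (p ^ s)%N -> (s <= n.-1)%N -> c \in <[a]> -> #[c] = (p ^ t)%N ->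
  #[u * c] = (p ^ maxn s t)%N.
Proof.
move=> ou les ac oc.
have /eqP q1 : (q == 1 %[mod p])%N by rewrite twist_mod_p ou dvdn_exp2l.
have ouc i : (#[u * c] %| p ^ i)%N = (maxn s t <= i)%N.
  rewrite order_dvdn expMgeom_eq1 // -!order_dvdn ou oc geq_max.
  rewrite (dvdn_Pexp2l _ _ (prime_gt1 p_pr)) pfactor_dvdn //.
    by rewrite logn_geom.
  by rewrite geom_gt0 // expn_gt0 prime_gt0.
have /dvdn_pfactor[//|l _ ol] : (#[u * c] %| p ^ maxn s t)%N by rewrite ouc.
rewrite ol; congr (p ^ _)%N.
have ls i : (l <= i)%N = (maxn s t <= i)%N by rewrite -ouc ol dvdn_Pexp2l ?prime_gt1.
by apply/eqP; rewrite eqn_leq ls leqnn -ls leqnn.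
Qed.

(** Conjugating u by a^(-j) gives u a^((q-1)j), and the order condition places c in the subgroup
    generated by a^(q-1). *)
Lemma conj_mul_twist c : c \in <[a]> -> (#[c] %| #[a ^+ q.-1])%N ->
  exists2 g, g \in G & u * c = u ^ g.
Proof.
move=> ac; rewrite /order (cardSg_cyclic (cycle_cyclic a)) ?cycle_subG ?mem_cycle //.
case/cycleP=> j ->; exists (a ^- j); first by rewrite groupV groupX.
rewrite /conjg invgK mulgA (conjgC _ u) conjXg au -mulgA -!expgM.
by congr (_ * _); apply: (canRL (mulgK _));
  rewrite -expgD mulnC -{2}(muln1 j) -mulnDr addn1 prednK // mulnC.
Qed.

End Twist.

Lemma order_expa_coprime k : coprime k p -> #[a ^+ k] = (p ^ n)%N.
Proof. by move=> co_k; rewrite orderXgcd oa (eqP (coprimeXl _ _)) ?divn1 // coprime_sym. Qed.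

(** With u = u0^m, the power (u0 c0)^m is u c1, where c1 has order p^t because the geometric sum is
    m modulo p. It generates the same subgroup, and a power of [b] moves c1 to c while fixing u. *)
Lemma cycle_mul_conj u u0 c c0 s t :
    u \in <[b]> -> u0 \in <[b]> -> c \in <[a]> -> c0 \in <[a]> ->
    #[u] = (p ^ s)%N -> #[u0] = (p ^ s)%N -> #[c] = (p ^ t)%N -> #[c0] = (p ^ t)%N ->
    (s <= n.-1)%N -> (s < t)%N ->
  <[u * c]> \in <[u0 * c0]> :^: G.
Proof.
move=> bu bu0 ac ac0 ou ou0 oc oc0 les ltst.
have [q0 q0_gt0 au0] := acts_exists bu0.
have [m co_m_p Du] : exists2 m, coprime m p & u = u0 ^+ m.
  (* For s = 0 coprimality to [#[u0]] = 1 says nothing about p, so m = 1 is chosen. *)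
  have [s0 | s_gt0] := posnP s.
    exists 1%N; first exact: coprime1n.
    move/eqP: ou ou0; rewrite s0 order_eq1 expg1 => /eqP-> /eqP.
    by rewrite order_eq1 => /eqP->.
  have [|m co_m ->] := @cycle_eq_expg _ u0 u.
    by apply/eqP; rewrite (eq_subG_cyclic (cycle_cyclic b)) ?cycle_subG // -!orderE ou ou0.
  by exists m; rewrite // -(coprime_pexpr _ _ s_gt0) -ou0.
have q01 : (q0 = 1 %[mod p])%N
  by apply/eqP; rewrite (twist_mod_p bu0 q0_gt0 au0) ou0 dvdn_exp2l.
pose c1 := c0 ^+ geom q0 m; have ac1 : c1 \in <[a]> by rewrite groupX.
have y_m : (u0 * c0) ^+ m = u * c1 by rewrite Du -(expMgeom au0).
have t_gt0 : (0 < t)%N by apply: leq_trans ltst.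
have co_geom : coprime (geom q0 m) p by rewrite -coprime_modl geom_mod // coprime_modl.
have oc1 : #[c1] = (p ^ t)%N.
  by rewrite orderXgcd oc0 (eqP (coprimeXl _ _)) ?divn1 // coprime_sym.
have cyc_y : <[u0 * c0]> = <[u * c1]>.
  apply/eqP; rewrite -y_m -[_ == _]/(generator _ _) generator_coprime.
  by rewrite (order_mul_twist bu0 q0_gt0 au0 ou0 les ac0 oc0) coprime_sym coprimeXr.
have [|i co_i Dc] := @cycle_eq_expg _ c1 c.
  by apply/eqP; rewrite (eq_subG_cyclic (cycle_cyclic a)) ?cycle_subG // -!orderE oc oc1.
rewrite oc1 coprime_pexpr // in co_i.
have [e abe] := b_onto_aut co_i.
apply/imsetP; exists (b ^+ e); first by rewrite groupX.
rewrite cyc_y -cycleJ conjMg; congr <[_ * _]>.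
  by apply/esym/conjg_fixP/commgP; case/cycleP: bu => k ->; apply: commuteX2.
by rewrite Dc; case/cycleP: ac1 => k ->; rewrite conjXg abe -!expgM mulnC.
Qed.

Let order_expa t : (t <= n)%N -> #[a ^+ (p ^ (n - t))] = (p ^ t)%N.
Proof.
move=> letn; rewrite orderXdiv oa ?dvdn_exp2l ?leq_subr //.
by rewrite -expnB ?prime_gt0 ?leq_subr // subKn.
Qed.

Let order_expb d : (d %| N)%N -> #[b ^+ (N %/ d)] = d.
Proof.
move=> d_N; have N_gt0 : (0 < N)%N by rewrite -ob order_gt0.
by rewrite -ob orderXdiv ?ob ?dvdn_div // divnA // mulKn.
Qed.

Let coset_order u c : u \in <[b]> -> c \in <[a]> -> #[coset <[a]> (u * c)] = #[u].
Proof.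
move=> bu ac; have [_ naG] := andP nsaG; have [_ _ _ tiab] := sdprodP defG.
have nau : u \in 'N(<[a]>) by rewrite (fintype.subsetP naG) ?(fintype.subsetP sbG).
have nac : c \in 'N(<[a]>) by rewrite (fintype.subsetP (normG _)).
have -> : coset <[a]> (u * c) = coset <[a]> u.
  by rewrite morphM //= [coset_morphism _ c]coset_id // mulg1.
apply/eqP; rewrite eqn_dvd !order_dvdn -morphX //=; apply/andP; split.
  by rewrite expg_order morph1.
apply/eqP; have : u ^+ #[coset <[a]> u] \in <[a]> :&: <[b]>.
  apply/setIP; split; last exact: groupX.
  by rewrite coset_idr ?groupX // morphX //= expg_order.
by rewrite tiab inE => /eqP.
Qed.

(* The image of x modulo <a> and x itself have orders that determine the
   conjugacy class of the subgroup <x>. *)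
Definition cycle_inv x := (#[coset <[a]> x], #[x]).

Lemma cycle_inv_conj x y :
  x \in G -> <[y]> \in <[x]> :^: G -> cycle_inv y = cycle_inv x.
Proof.
move=> Gx /imsetP[g Gg eq_yx]; have [_ naG] := andP nsaG.
have nag : g \in 'N(<[a]>) by rewrite (fintype.subsetP naG).
have nax : x \in 'N(<[a]>) by rewrite (fintype.subsetP naG).
have Gy : y \in G by rewrite -cycle_subG eq_yx conj_subG ?cycle_subG.
have nay : y \in 'N(<[a]>) by rewrite (fintype.subsetP naG).
congr (_, _); rewrite /order; last by rewrite eq_yx cardJg.
by rewrite -!quotient_cycle // eq_yx quotientJ // cardJg.
Qed.

(** Exponents of the orders of u and c for the subgroups <u c> not conjugate into <b>. *)
Let pairs := [seq (s, t) | s <- iota 0 n, t <- iota s.+1 (n - s)].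

Let pairsP s t : ((s, t) \in pairs) = (s < t)%N && (t <= n)%N.
Proof.
apply/allpairsPdep/andP=> [[s' [t' []]] | [ltst letn]].
  rewrite !mem_iota add0n => /andP[_ lts] /andP[ltst lett] [-> ->].
  by split; rewrite // -ltnS (leq_trans lett) // addSn subnKC // ltnW.
exists s, t; split; rewrite // mem_iota; first by rewrite (leq_trans ltst).
by rewrite ltst addSn subnKC // ltnW // (leq_trans ltst).
Qed.

Let size_pairs : size pairs = (n * n.+1 %/ 2)%N.
Proof.
rewrite size_allpairs_dep sumnE big_map -sum_iota_subn.
by under eq_bigr => s _ do rewrite size_iota.
Qed.

Let reps := [seq b ^+ (N %/ d) | d <- divisors N]
  ++ [seq b ^+ (N %/ p ^ st.1) * a ^+ (p ^ (n - st.2)) | st <- pairs].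

(** Equal entries mark the subgroups of <b>; the other keys have p^s < p^t, so the two families are
    disjoint. *)
Let keys := [seq (d, d) | d <- divisors N] ++ [seq (p ^ st.1, p ^ st.2)%N | st <- pairs].

Let ps_N s : (s < n)%N -> (p ^ s %| N)%N.
Proof. by move=> lts; rewrite dvdn_mulr // dvdn_exp2l // -ltnS prednK. Qed.

Let inv_reps : map cycle_inv reps = keys.
Proof.
rewrite map_cat -!map_comp; congr (_ ++ _); apply/eq_in_map.
  move=> d; rewrite -dvdn_divisors -?ob ?order_gt0 // ob => d_N.
  rewrite /= /cycle_inv order_expb // -[b ^+ _]mulg1.
  by rewrite coset_order ?mem_cycle ?group1 // order_expb.
case=> s t; rewrite pairsP => /andP[ltst letn] /=; have lts := leq_trans ltst letn.
have bu : b ^+ (N %/ p ^ s) \in <[b]> by rewrite mem_cycle.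
have ac : a ^+ (p ^ (n - t)) \in <[a]> by rewrite mem_cycle.
have [q q_gt0 aq] := acts_exists bu.
rewrite /cycle_inv coset_order // order_expb ?ps_N //.
rewrite (order_mul_twist bu q_gt0 aq (order_expb (ps_N lts)) _ ac (order_expa letn)).
  by rewrite (maxn_idPr (ltnW ltst)).
by rewrite -ltnS prednK.
Qed.

Let uniq_keys : uniq keys.
Proof.
rewrite cat_uniq map_inj_uniq ?divisors_uniq /=; last by move=> d e [].
apply/andP; split.
  apply/hasPn => _ /mapP[[s t] + ->] /=; rewrite pairsP => /andP[ltst _].
  apply/mapP=> -[d _ [es et]]; move/eqP: (etrans es (esym et)).
  by rewrite eqn_exp2l ?prime_gt1 // => /eqP ts; rewrite ts ltnn in ltst.
rewrite map_inj_uniq => [|[s t] [s' t'] /= [es et]]; last first.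
  by congr (_, _); apply/eqP; rewrite -(eqn_exp2l _ _ (prime_gt1 p_pr)) (es, et).
apply: allpairs_uniq_dep => [|s _|]; rewrite ?iota_uniq //.
by move=> [s t] [s' t'] _ _ /= [-> ->].
Qed.

(** For x = u c: if q is not 1 modulo p, then a^(q-1) generates <a> and c is absorbed by
    conjugation. Otherwise u and a^(q-1) both have order p^s, and c is absorbed unless its order
    exceeds p^s. *)
Let reps_exhaust x : x \in G -> exists2 y, y \in reps & <[x]> \in <[y]> :^: G.
Proof.
move=> Gx; have N_gt0 : (0 < N)%N by rewrite -ob order_gt0.
have [_ mulab nab _] := sdprodP defG.
have /mulsgP[u c bu ac ->] : x \in <[b]> * <[a]> by rewrite (normC nab) mulab.
have [q q_gt0 aq] := acts_exists bu.
have ou_N : (#[u] %| N)%N by rewrite -ob -[#[b]]/#|_| order_dvdG.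
have [m _ om] : exists2 m, (m <= n)%N & #[c] = (p ^ m)%N.
  by apply/dvdn_pfactor; rewrite // -oa -[#[a]]/#|_| order_dvdG.
have base : (#[c] %| #[a ^+ q.-1])%N ->
    exists2 y, y \in reps & <[u * c]> \in <[y]> :^: G.
  move/(conj_mul_twist q_gt0 aq ac)=> [g Gg ->].
  exists (b ^+ (N %/ #[u])).
    rewrite /reps mem_cat; apply/orP; left; apply/mapP.
    by exists #[u]; rewrite -?dvdn_divisors.
  apply/imsetP; exists g => //; rewrite cycleJ; congr (_ :^ _); apply/eqP.
  rewrite (eq_subG_cyclic (cycle_cyclic b)) ?cycle_subG ?mem_cycle //.
  by rewrite -!orderE order_expb.
have [q1 | q_neq1] := boolP (q == 1 %[mod p])%N; last first.
  apply: base; rewrite order_expa_coprime; first by rewrite -oa -[#[a]]/#|_| order_dvdG.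
  rewrite coprime_sym prime_coprime // -subn1 -eqn_mod_dvd //.
have := q1; rewrite (twist_mod_p bu q_gt0 aq) => /dvdn_pfactor[//|s les ou].
have [lems | ltsm] := leqP m s.
  by apply: base; rewrite (order_twist bu q_gt0 aq ou les) om dvdn_exp2l.
have lemn : (m <= n)%N.
  by rewrite -(dvdn_Pexp2l m n (prime_gt1 p_pr)) -om -oa -[#[a]]/#|_| order_dvdG.
have lts := leq_trans ltsm lemn.
exists (b ^+ (N %/ p ^ s) * a ^+ (p ^ (n - m))).
  rewrite /reps mem_cat; apply/orP; right; apply/mapP; exists (s, m) => //.
  by rewrite pairsP ltsm.
apply: (cycle_mul_conj bu _ ac _ ou (order_expb (ps_N lts)) om (order_expa lemn));
  by rewrite ?mem_cycle.
Qed.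

Lemma card_irr_rat_hol (sG : irrType rat G) :
  #|sG| = (size (divisors N) + n * n.+1 %/ 2)%N.
Proof.
transitivity (size reps); last by rewrite size_cat !size_map size_pairs.
apply: (@card_irr_rat _ G sG _ cycle_inv reps _ _ cycle_inv_conj reps_exhaust);
  last by rewrite inv_reps.
move=> x; rewrite /reps mem_cat => /orP[] /mapP[y _ ->]; by rewrite ?groupM // groupX.
Qed.

(** G / <a> is abelian. Conversely [a, b] = a^(r-1) generates <a>: r is not 1 modulo p, because the
    order of [b] does not divide p^(n-1). *)
Lemma hol_der1 : G^`(1) = <[a]>.
Proof.
have [_ mulab nab _] := sdprodP defG; have [_ naG] := andP nsaG.
apply/eqP; rewrite finset.eqEsubset; apply/andP; split.
  rewrite der1_min // -mulab quotientMidl quotient_abelian //.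
  exact/cyclic_abelian/cycle_cyclic.
have r_gt0 : (0 < r)%N.
  case: posnP prim_r => // -> /prim_expr_order /=.
  by rewrite expr0n -[N == 0%N]negbK -lt0n -ob order_gt0 /= => /eqP; rewrite eq_sym oner_eq0.
have rN1 : coprime r.-1 p.
  rewrite coprime_sym prime_coprime // -subn1 -eqn_mod_dvd //.
  rewrite (twist_mod_p (cycle_id b) r_gt0 ab) ob /N -[X in (_ %| X)%N]muln1.
  rewrite dvdn_pmul2l ?expn_gt0 ?prime_gt0 // dvdn1 gtn_eqF //.
  by rewrite -ltnS prednK ?prime_gt0 // odd_prime_gt2.
have -> : <[a]> = <[a ^+ r.-1]>.
  apply/esym/eqP; rewrite eqEcard cycle_subG mem_cycle /= -!orderE.
  by rewrite order_expa_coprime // oa.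
rewrite cycle_subG; suffices -> : a ^+ r.-1 = [~ a, b] by rewrite mem_commg.
rewrite commgEl ab; apply: (canRL (mulKg _)); by rewrite -expgS prednK.
Qed.

Lemma hol_quotient_der1 : G / G^`(1) = <[coset G^`(1) b]>.
Proof.
have [_ mulab nab _] := sdprodP defG; have [_ naG] := andP nsaG.
rewrite hol_der1 -mulab quotientMidl quotient_cycle //.
by rewrite -cycle_subG.
Qed.

Lemma index_hol_der1 : #|G : G^`(1)| = N.
Proof.
have [_ _ _ tiab] := sdprodP defG.
rewrite hol_der1 -divgS ?normal_sub // -(sdprod_card defG) mulKn ?cardG_gt0 //.
Qed.

(** This makes the presentation available for every primitive r': [b] is replaced by its power that
    acts on [a] as r'. *)
Lemma hol_generator r' : N.-primitive_root (r'%:R : 'Z_(p ^ n)) ->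
  exists b', [/\ <[a]> ><| <[b']> = G, #[b'] = N & a ^ b' = a ^+ r'].
Proof.
move=> prim_r'; have N_gt0 : (0 < N)%N by apply: prim_order_gt0 prim_r.
have co_r'_p : coprime r' p.
  have : (r'%:R : 'Z_(p ^ n))%R \is a GRing.unit.
    by rewrite -(unitrX_pos _ N_gt0) (prim_expr_order prim_r') unitr1.
  by rewrite unitZpE // coprime_pexpl // coprime_sym.
have [e ab'] := b_onto_aut co_r'_p.
have ab'X k : a ^ (b ^+ e ^+ k) = a ^+ (r' ^ k).
  elim: k => [|k IHk]; first by rewrite conjg1.
  by rewrite expgSr conjgM IHk conjXg ab' -expgM expnS.
have ob' : #[b ^+ e] = N.
  apply/eqP; rewrite eqn_dvd -{1}ob orderXdvd (prim_order_dvd prim_r') /=.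
  rewrite -natrX -[1%R]/(1%:R)%R Zp_natr_eq -expa_eq -ab'X.
  by rewrite expg_order conjg1.
exists (b ^+ e); split=> //; rewrite -defG; congr (_ ><| _).
by apply/eqP; rewrite eqEcard cycle_subG mem_cycle -!orderE ob ob' leqnn.
Qed.

(** Elements x, y satisfying the relations give morphisms on <a> and <b> compatible with the
    actions; these glue over the semidirect product. *)
Lemma isoGrp_hol :
  G \isog Grp (x : y : x ^+ (p ^ n) = 1, y ^+ N = 1, y^-1 * x * y = x ^+ r).
Proof.
apply: intro_isoGrp => [|rT H].
  apply/existsP; exists (a, b); rewrite /= !xpair_eqE; apply/andP; split.
    by case/sdprodP: defG => _ <- nab _; rewrite norm_joinEr.
  by rewrite -oa -ob !expg_order -ab /conjg mulgA !eqxx.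
case/existsP=> -[x y] /= /eqP[defH xpn yN xy].
have fxP : (#[x] %| #[a])%N by rewrite order_dvdn oa xpn.
have fyP : (#[y] %| #[b])%N by rewrite order_dvdn ob yN.
have {}xy : x ^ y = x ^+ r by rewrite /conjg mulgA.
have xyX k : x ^ (y ^+ k) = x ^+ (r ^ k).
  elim: k => [|k IHk]; first by rewrite conjg1.
  by rewrite expgSr conjgM IHk conjXg xy -expgM expnS.
have fP : {in <[a]> & <[b]>, morph_act 'J 'J (eltm fxP) (eltm fyP)}.
  move=> _ _ /cycleP[i ->] /cycleP[j ->]; rewrite /= conjXg conj_bX -expgM !eltmE.
  by rewrite conjXg xyX expgM.
apply/homgP; exists (sdprodm_morphism defG fP).
rewrite /= im_sdprodm !morphim_cycle ?cycle_id //= !eltm_id -norm_joinEr //.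
by rewrite norms_cycle xy mem_cycle.
Qed.

End Holomorph.

(** * Generators of the holomorph *)

Lemma Aut_cyclic_odd_pgroup (p : nat) (gT : finGroupType) (C : {group gT}) :
  p.-group C -> odd p -> cyclic C -> C :!=: 1%g -> cyclic (Aut C).
Proof.
move=> pC p_odd cycC ntC.
have [m [_ [_ cycF _ _]]] := cyclic_pgroup_Aut_structure pC cycC ntC.
by case: eqP => [_ -> // | _ [t [_ _ _]]]; rewrite p_odd => -[[]].
Qed.

(** [a] and [b] are the images of generators of C and of Aut C, which is cyclic as p is odd; r is
    the exponent by which the latter acts. *)
Lemma Hol_generators (p n : nat) (gT : finGroupType) (C : {group gT}) :
    prime p -> odd p -> (0 < n)%N -> cyclic C -> #|C| = (p ^ n)%N ->
  exists (a b : sdprod_by [Aut C]%gact) (r : nat),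
    [/\ (<[a]> ><| <[b]>)%g = Hol C, #[a]%g = (p ^ n)%N,
        #[b]%g = (p ^ n.-1 * p.-1)%N, (a ^ b = a ^+ r)%g
      & (p ^ n.-1 * p.-1)%N.-primitive_root (r%:R : 'Z_(p ^ n))].
Proof.
move=> p_pr p_odd n_gt0 cycC oC.
have pn_gt1 : (1 < p ^ n)%N by rewrite -(exp1n n) ltn_exp2r ?prime_gt1.
have ntC : C :!=: 1%g by rewrite -cardG_gt1 oC.
have pC : p.-group C by rewrite /pgroup oC pnatX pnat_id.
have /cyclicP[f defA] := Aut_cyclic_odd_pgroup pC p_odd cycC ntC.
have /cyclicP[x defC] := cycC.
have Cx : x \in C by rewrite defC cycle_id.
have Af : f \in Aut C by rewrite defA cycle_id.
have ox : #[x]%g = (p ^ n)%N by rewrite orderE -defC.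
have of_ : #[f]%g = (p ^ n.-1 * p.-1)%N.
  by rewrite orderE -defA card_Aut_cyclic // oC totient_pfactor // mulnC.
have [r fx] : exists r, f x = (x ^+ r)%g.
  by apply/cycleP; rewrite -defC Aut_closed.
have fxX k : (f ^+ k)%g x = (x ^+ (r ^ k))%g.
  elim: k => [|k IHk]; first by rewrite perm1.
  rewrite expgSr permM IHk -(autmE Af) morphX //= autmE fx -expgM.
  by rewrite expnS.
exists (sdpair1 [Aut C]%gact x), (sdpair2 [Aut C]%gact f), r; split.
- rewrite -!morphim_cycle //= -defC -defA; exact: sdprod_sdpair.
- by rewrite order_injm ?injm_sdpair1.
- by rewrite order_injm ?injm_sdpair2.
- by rewrite -sdpair_act // -morphX // -fx.
(* An automorphism of C is determined at the generator x, so r^k = 1 exactly when f^k = 1. *)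
have rX k : ((r%:R ^+ k == 1 :> 'Z_(p ^ n)) = (#[f]%g %| k)%N)%R.
  rewrite -natrX -[1%R]/(1%:R)%R Zp_natr_eq // -ox -eq_expg_mod_order -fxX.
  rewrite expg1 order_dvdn; apply/eqP/eqP => [fkx | ->]; last by rewrite perm1.
  apply: (eq_Aut (groupX k Af) (group1 _)) => y; rewrite defC => /cycleP[i ->].
  by rewrite -(autmE (groupX k Af)) morphX //= autmE fkx perm1.
have rf1 : (r%:R ^+ #[f]%g = 1 :> 'Z_(p ^ n))%R by apply/eqP; rewrite rX.
have [m prim_m m_dv] := prim_order_exists (order_gt0 f) rf1.
suffices <- : m = (p ^ n.-1 * p.-1)%N by [].
apply/eqP; rewrite -of_ eqn_dvd m_dv -rX.
by rewrite (prim_expr_order prim_m) eqxx.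
Qed.

(** * Cyclotomic polynomials *)

Lemma root_PhiQ m (z : algC) : (0 < m)%N ->
  root (map_poly ratr (PhiQ m)) z = m.-primitive_root z.
Proof.
move=> m_gt0; have [w prim_w] := C_prim_root_exists m_gt0.
rewrite -(root_cyclotomic prim_w) -(Cintr_Cyclotomic prim_w) /PhiQ -map_poly_comp.
by congr (root _ z); apply: eq_map_poly => k; rewrite /= rmorph_int.
Qed.

Lemma PhiQ_inj : {in [pred m | (0 < m)%N] &, injective PhiQ}.
Proof.
move=> d e d_gt0 e_gt0 eq_de; have [z prim_z] := C_prim_root_exists d_gt0.
have prim_ze : e.-primitive_root z by rewrite -root_PhiQ // -eq_de root_PhiQ.
apply/eqP; rewrite eqn_dvd (prim_order_dvd prim_z) (prim_order_dvd prim_ze).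
by rewrite (prim_expr_order prim_z) (prim_expr_order prim_ze) eqxx.
Qed.

Lemma PhiQ_monic m : PhiQ m \is monic.
Proof. exact: monic_map (Cyclotomic_monic m). Qed.

(** It is the minimal polynomial over Q of a primitive m-th root of unity. *)
Lemma PhiQ_irreducible m : (0 < m)%N -> irreducible_poly (PhiQ m).
Proof.
move=> m_gt0; have [z prim_z] := C_prim_root_exists m_gt0.
have [f [Df _] dv_f] := minCpolyP z.
have -> : PhiQ m = f.
  apply: (map_poly_inj (ratr : {rmorphism rat -> algC})) => /=.
  rewrite -Df (minCpoly_cyclotomic prim_z) -(Cintr_Cyclotomic prim_z) -map_poly_comp.
  by apply: eq_map_poly => k; rewrite /= rmorph_int.
have f_z : root (map_poly ratr f) z by rewrite dv_f.
have f_neq0 : f != 0.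
  by apply: contraTneq (monic_neq0 (minCpoly_monic z)) => f0; rewrite Df f0 map_poly0 eqxx.
split=> [|q q_neq1 /dvdpP[h Dh]].
  by rewrite -(size_map_poly (ratr : {rmorphism rat -> algC})) -Df size_minCpoly.
have : root (map_poly ratr q) z || root (map_poly ratr h) z.
  by rewrite orbC -rootM -rmorphM /= -Dh.
rewrite !dv_f => /orP[fq | fh]; first by rewrite /eqp fq Dh dvdp_mull.
have [h0 | h_neq0] := eqVneq h 0; first by rewrite Dh h0 mul0r eqxx in f_neq0.
have q_neq0 : q != 0 by apply: contraNneq f_neq0 => q0; rewrite Dh q0 mulr0.
(* If f divides the cofactor h, comparing degrees makes q constant. *)
have := dvdp_leq h_neq0 fh; rewrite Dh size_mul // -ltnS prednK.
  rewrite -addn1 leq_add2l => le_q1; case/negP: q_neq1.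
  by rewrite eqn_leq le_q1 lt0n size_poly_eq0.
by rewrite addn_gt0 lt0n size_poly_eq0 h_neq0.
Qed.

Lemma card_PhiQ_divisors N : (0 < N)%N ->
  [set PhiQ d | d in [set d | (d %| N)%N]] #= `I_(size (divisors N)).
Proof.
move=> N_gt0; apply: card_eq_trans (_ : [set d | (d %| N)%N] #= _).
  apply: inj_card_eq => d e; rewrite !inE => d_N e_N.
  by apply: PhiQ_inj; rewrite inE (dvdn_gt0 N_gt0).
have -> : [set d | (d %| N)%N] = [set d | d \in divisors N].
  by apply/seteqP; split=> d /=; rewrite dvdn_divisors.
exact/card_seq/divisors_uniq.
Qed.

Lemma card_PhiQ_pairs p n : prime p ->
  [set kq : nat * {poly rat} | (1 <= kq.1 <= n)%N /\
      exists2 j : nat, (j <= n - kq.1)%N & kq.2 = PhiQ (p ^ j)]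
    #= `I_(n * n.+1 %/ 2).
Proof.
move=> p_pr; pose s := [seq (k, PhiQ (p ^ j)) | k <- iota 1 n, j <- iota 0 (n - k).+1].
have us : uniq s.
  apply: allpairs_uniq_dep => [|k _|]; rewrite ?iota_uniq //.
  move=> [k j] [k' j'] _ _ /= [-> /PhiQ_inj].
  rewrite !inE !expn_gt0 prime_gt0 // => /(_ isT isT)/eqP.
  by rewrite eqn_exp2l ?prime_gt1 // => /eqP->.
have <- : size s = (n * n.+1 %/ 2)%N.
  (* The shift k = s + 1 turns the n - k + 1 exponents for k into n - s. *)
  rewrite size_allpairs_dep sumnE big_map -sum_iota_subn -[1%N]addn0 iotaDl big_map.
  rewrite big_seq [RHS]big_seq; apply: eq_bigr => i; rewrite mem_iota => /andP[_ lt_in].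
  by rewrite size_iota add1n subnSK.
rewrite [X in X #= _](_ : _ = [set kq | kq \in s]); first exact: card_seq.
apply/seteqP; split=> [[k q] /= [/andP[k_gt0 le_kn] [j le_j ->]] | kq /=].
  by apply/allpairsPdep; exists k, j; rewrite !mem_iota add1n ltnS k_gt0.
case/allpairsPdep=> k [j []]; rewrite !mem_iota add1n ltnS => k_n le_j -> /=.
by split=> //; exists j.
Qed.

(** * Assembling the counts *)

Lemma card_Qirr_classes_all (gT : finGroupType) (G : {group gT}) (sG : irrType rat G) :
  Qirr_classes (fun _ : Qrep G => True) #= `I_#|sG|.
Proof.
have -> : (fun _ : Qrep G => True) = (fun rho => is_true ((fun _ => true) rho)).
  by apply/funext => rho; apply/propext; split.
exact: (@card_Qirr_classes _ G sG (fun _ => true)).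
Qed.

Lemma card_Qirr_classes_cyclic_quotient (gT : finGroupType) (G N : {group gT}) :
    N <| G -> cyclic (G / N) ->
  Qirr_classes (fun rho : Qrep G => N \subset Qrep_ker rho)
    #= `I_(size (divisors #|G : N|)).
Proof.
move=> nsNG cycG; have [_ nNG] := andP nsNG.
have [sG] := socleType_inhabited (regular_repr rat (G / N)).
apply: card_eq_trans (card_Qirr_classes_quotient nsNG) _.
by rewrite -card_quotient // -(card_irr_rat_cyclic sG) //; apply: card_Qirr_classes_all.
Qed.

(** Cardinals can be subtracted once all counts are transported to the finite type [sG]. *)
Lemma card_Qirr_classesC (gT : finGroupType) (G : {group gT}) (P : Qrep G -> bool) k l :
    (forall rho rho', Qrep_equiv rho rho' -> P rho = P rho') ->
    Qirr_classes (fun rho => P rho) #= `I_k ->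
    Qirr_classes (fun _ : Qrep G => True) #= `I_(k + l) ->
  Qirr_classes (fun rho => ~~ P rho) #= `I_l.
Proof.
move=> Pequiv cardP cardT; have [sG] := socleType_inhabited (regular_repr rat G).
have kE : k = #|[pred i : sG | P (existT _ _ (irr_repr i))]|.
  apply/card_eq_II; rewrite card_eq_sym in cardP.
  exact: card_eq_trans cardP (card_Qirr_classes sG Pequiv).
have klE : (k + l)%N = #|sG|.
  apply/card_eq_II; rewrite card_eq_sym in cardT.
  exact: card_eq_trans cardT (card_Qirr_classes_all sG).
have -> : l = #|[pred i : sG | ~~ P (existT _ _ (irr_repr i))]|.
  apply/eqP; rewrite -(eqn_add2l k) klE.
  by rewrite -(cardC [pred i : sG | P (existT _ _ (irr_repr i))]) -kE.
by apply: (@card_Qirr_classes _ G sG (fun rho => ~~ P rho)) => rho rho' /Pequiv->.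
Qed.

Theorem theorem7p0p2 (p n : nat) (gT : finGroupType) (C : {group gT})
    (p_prime : prime p) (p_odd : odd p) (n_ge1 : (1 <= n)%N)
    (C_cyclic : cyclic C) (card_C : #|C| = (p ^ n)%N) :
  let G := Hol C in
  [/\ (* the presentation of G *)
      forall r : nat,
        (p ^ n.-1 * p.-1)%N.-primitive_root (r%:R : 'Z_(p ^ n)) ->
        (G \isog Grp (a : b : a ^+ (p ^ n) = 1,
                              b ^+ (p ^ n.-1 * p.-1) = 1,
                              b^-1 * a * b = a ^+ r))%g,
      (* the polynomials below are monic and irreducible over Q *)
      forall m : nat, (1 <= m)%N ->
        PhiQ m \is monic /\ irreducible_poly (PhiQ m),
      (* 1 *)
      Qirr_classes (fun rho : Qrep G => G^`(1)%g \subset Qrep_ker rho)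
        #= galois_classes_degree1 G /\
      Qirr_classes (fun rho : Qrep G => G^`(1)%g \subset Qrep_ker rho)
        #= [set PhiQ d | d in [set d | (d %| totient (p ^ n))%N]],
      (* 2 *)
      Qirr_classes (fun rho : Qrep G => ~~ (G^`(1)%g \subset Qrep_ker rho))
        #= [set kq : nat * {poly rat} | (1 <= kq.1 <= n)%N /\
              exists2 j : nat, (j <= n - kq.1)%N & kq.2 = PhiQ (p ^ j)]
    & (* 3 *)
      Qirr_classes (fun _ : Qrep G => True)
        #= `I_(size (divisors (totient (p ^ n))) + (n * n.+1) %/ 2)].
Proof.
move=> G; have [a [b [r [defG oa ob ab prim_r]]]] :=
  Hol_generators p_prime p_odd n_ge1 C_cyclic card_C.
have totN : totient (p ^ n) = (p ^ n.-1 * p.-1)%N by rewrite totient_pfactor // mulnC.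
have N_gt0 : (0 < totient (p ^ n))%N by rewrite totN -ob order_gt0.
have [sG] := socleType_inhabited (regular_repr rat G).
have iG' : #|G : G^`(1)|%g = totient (p ^ n).
  by rewrite totN (index_hol_der1 p_prime p_odd n_ge1 defG oa ob ab prim_r).
have genG' := hol_quotient_der1 p_prime p_odd n_ge1 defG oa ob ab prim_r.
have Gb : b \in G by rewrite inE.
have cardT : Qirr_classes (fun _ : Qrep G => True)
    #= `I_(size (divisors (totient (p ^ n))) + (n * n.+1) %/ 2).
  rewrite totN -(card_irr_rat_hol p_prime p_odd n_ge1 defG oa ob ab prim_r sG).
  exact: card_Qirr_classes_all.
have cardG' : Qirr_classes (fun rho : Qrep G => G^`(1)%g \subset Qrep_ker rho)
    #= `I_(size (divisors (totient (p ^ n)))).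
  rewrite -iG'; apply: card_Qirr_classes_cyclic_quotient; first exact: der_normal.
  by rewrite /= genG' cycle_cyclic.
have card_Phi := card_PhiQ_divisors N_gt0.
split=> //.
- move=> r' prim_r'.
  have [b' [defG' ob' ab']] :=
    hol_generator p_prime n_ge1 defG oa ob ab prim_r prim_r'.
  exact: (isoGrp_hol defG' oa ob' ab').
- by move=> m m_gt0; split; [apply: PhiQ_monic | apply: PhiQ_irreducible].
- split; last by apply: card_eq_trans cardG' _; rewrite card_eq_sym.
  apply: card_eq_trans cardG' _; rewrite card_eq_sym.
  apply: card_eq_trans (card_galois_classes_degree1 Gb genG') _.
  rewrite iG'; apply: card_eq_trans card_Phi; rewrite card_eq_sym.
  apply: inj_card_eq => d e; rewrite !inE => d_N e_N.
  by apply: PhiQ_inj; rewrite inE (dvdn_gt0 N_gt0).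
(* Removing the representations trivial on G' from the total leaves n (n + 1) / 2 classes, the
   number of pairs. *)
rewrite (card_eqr (card_PhiQ_pairs n p_prime)).
apply: card_Qirr_classesC cardG' cardT => rho rho' /Qrep_equiv_ker.
by move->.
Qed.
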